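(* Let a price function $P:\mathbb{R}_{\ge 0}\to\mathbb{R}_{\ge 0}$ be given. All distance tariffs with respect to $P$ (on all PTNs) satisfy the no-elongation property if and only if $P$ is increasing.
   Context: ''Increasing'' means non-decreasing ($a\le b$ implies $P(a)\le P(b)$). A PTN is a finite, simple, connected, undirected graph $(V,E)$, here with a positive physical length assigned to each edge. A path is a finite sequence $(x_1,\dots,x_n)$, $n\ge 1$, of (not necessarily distinct) nodes with consecutive nodes adjacent; $\mathcal{W}$ is the set of all paths; $l(W)$ is the sum of the edge lengths along $W$ (so $l=0$ for a one-node path); $[x_i,x_j]$ denotes the subpath $(x_i,\dots,x_j)$. A fare structure is a function $p:\mathcal{W}\to\mathbb{R}_{\ge 0}$. It is a distance tariff with respect to $P$ if $p(W)=P(l(W))$ for all $W\in\mathcal{W}$. No-elongation property: $p([x_1,x_{n-1}])\le p([x_1,x_n])$ for all paths $(x_1,\dots,x_n)\in\mathcal{W}$, $n\ge 2$. *)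

(* Defs.v *)
From HB Require Import structures.
From mathcomp Require Import all_boot all_order all_algebra.
From mathcomp Require Import interval_inference reals.

Set Implicit Arguments.
Unset Strict Implicit.
Unset Printing Implicit Defensive.

Import Order.TTheory GRing.Theory Num.Theory.
Local Open Scope ring_scope.

(* Edges are two-element sets of nodes, which makes the graph simple and
   undirected. The values of edge_length outside edges play no role. *)
Record ptn (R : realType) := Ptn {
  node : finType;
  edges : {set {set node}};
  edge_length : {set node} -> R;
  card_edge : forall e, e \in edges -> #|e| = 2%N;
  edge_length_gt0 : forall e, e \in edges -> 0 < edge_length e;
  ptn_connected :
    forall x y, connect (fun a b : node => [set a; b] \in edges) x y
}.

Definition adj (R : realType) (G : ptn R) : rel (node G) :=
  fun x y => [set x; y] \in edges G.

Definition is_walk (R : realType) (G : ptn R) (s : seq (node G)) : bool :=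
  if s is x :: s' then path (@adj R G) x s' else false.

Definition walk (R : realType) (G : ptn R) := {s : seq (node G) | is_walk s}.

Definition steps (R : realType) (G : ptn R) (s : seq (node G)) :
    seq {set node G} :=
  if s is x :: s' then pairmap (fun a b => [set a; b]) x s' else [::].

Lemma walk_length_ge0 (R : realType) (G : ptn R) (W : walk G) :
  0 <= \sum_(e <- steps (val W)) edge_length e.
Proof.
case: W => [[|x s] //=]; elim: s x => [|y s IHs] x /=; first by rewrite big_nil.
case/andP=> xy ys; rewrite big_cons addr_ge0 ?IHs //.
exact/ltW/edge_length_gt0.
Qed.

Definition walk_length (R : realType) (G : ptn R) (W : walk G) : {nonneg R} :=
  NngNum (walk_length_ge0 W).

Definition fare_structure (R : realType) (G : ptn R) := walk G -> {nonneg R}.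

Definition distance_tariff (R : realType) (P : {nonneg R} -> {nonneg R})
    (G : ptn R) (p : fare_structure G) : Prop :=
  forall W, p W = P (walk_length W).

(* W = (x_1, ..., x_n) and W' = (x_1, ..., x_(n-1)); since the walk W' is
   nonempty, n >= 2. *)
Definition no_elongation (R : realType) (G : ptn R) (p : fare_structure G) :
    Prop :=
  forall (W W' : walk G) (xn : node G),
    val W = rcons (val W') xn -> p W' <= p W.

(* Main.v *)
Require Import Defs.
From HB Require Import structures.
From mathcomp Require Import all_boot all_order all_algebra.
From mathcomp Require Import interval_inference reals.

(** Removing the last node of a walk removes one edge, so it shortens the walk
    by the positive length of that edge ([sum_steps_rcons]). A tariff given by
    an increasing price function therefore cannot charge more for the shortened
    walk.

    Conversely, any two prices [P a] and [P b] with [a < b] occur as fares of a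
    walk and of its extension by one edge of length [b - a]. If [0 < a], the
    shortened walk can be one edge of length [a]. If [a = 0] it must be a
    single node instead, since edge lengths are positive. A complete graph with
    freely chosen positive lengths ([complete_ptn]) contains these walks and is
    connected for trivial reasons. *)

Set Implicit Arguments.
Unset Strict Implicit.
Unset Printing Implicit Defensive.

Import Order.TTheory GRing.Theory Num.Theory.
Local Open Scope ring_scope.

Lemma sum_steps_rcons (R : realType) (G : ptn R) (x : node G)
    (s : seq (node G)) (y : node G) :
  \sum_(e <- steps (rcons (x :: s) y)) edge_length e =
  \sum_(e <- steps (x :: s)) edge_length e + edge_length [set last x s; y].
Proof.
rewrite rcons_cons /=; elim: s x => [|z s IHs] x /=.
  by rewrite big_cons !big_nil addrC.
by rewrite !big_cons IHs addrA.
Qed.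

Lemma increasing_no_elongation (R : realType) (P : {nonneg R} -> {nonneg R})
    (G : ptn R) (p : fare_structure G) :
  {homo P : a b / a <= b} -> distance_tariff P p -> no_elongation p.
Proof.
move=> P_incr pE [W walkW] [[|x s] walkW'] y //= defW.
rewrite !pE; apply: P_incr; rewrite -num_le /= defW -rcons_cons.
rewrite sum_steps_rcons lerDl ltW //; apply: edge_length_gt0.
by move: walkW; rewrite defW /= rcons_path => /andP[].
Qed.

Section CompletePtn.

Variables (R : realType) (T : finType) (len : {set T} -> R).
Hypothesis len_gt0 : forall e, 0 < len e.

Let all_pairs := [set e : {set T} | #|e| == 2%N].

Let card_all_pairs e : e \in all_pairs -> #|e| = 2%N.
Proof. by rewrite inE => /eqP. Qed.

Let connect_all_pairs x y : connect (fun a b => [set a; b] \in all_pairs) x y.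
Proof.
have [->|neq_xy] := eqVneq x y; first exact: connect0.
by apply: connect1; rewrite inE cards2 neq_xy.
Qed.

Definition complete_ptn : ptn R :=
  Ptn card_all_pairs (fun e _ => len_gt0 e) connect_all_pairs.

Lemma adj_complete (x y : T) : adj (G := complete_ptn) x y = (x != y).
Proof. by rewrite /adj inE cards2 eqSS eqb1. Qed.

End CompletePtn.

(** The form in which the no-elongation property is applied to a concrete
    network: the two lengths are arguments, so that they can be matched with
    prescribed values. *)
Lemma price_le_rcons (R : realType) (P : {nonneg R} -> {nonneg R}) (G : ptn R)
    (s : seq (node G)) (y : node G) (a b : {nonneg R}) :
    (forall p : fare_structure G, distance_tariff P p -> no_elongation p) ->
    is_walk s -> is_walk (rcons s y) ->
    \sum_(e <- steps s) edge_length e = a%:num ->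
    \sum_(e <- steps (rcons s y)) edge_length e = b%:num ->
  P a <= P b.
Proof.
move=> no_elong walk_s walk_sy len_s len_sy.
pose W' : walk G := exist _ s walk_s.
pose W : walk G := exist _ (rcons s y) walk_sy.
have -> : a = walk_length W' by apply/val_inj/esym.
have -> : b = walk_length W by apply/val_inj/esym.
exact: (no_elong (fun V => P (walk_length V)) (fun=> erefl) W W' y).
Qed.

Theorem theorem10 (R : realType) (P : {nonneg R} -> {nonneg R}) :
  (forall (G : ptn R) (p : fare_structure G),
      distance_tariff P p -> no_elongation p)
  <-> (forall a b : {nonneg R}, a <= b -> P a <= P b).
Proof.
split=> [no_elong a b|P_incr G p]; last exact: increasing_no_elongation.
rewrite le_eqVlt => /predU1P[-> //|]; rewrite -num_lt => lt_ab.
have [a0|a_neq0] := eqVneq a%:num 0.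
  have b_gt0 : 0 < b%:num by rewrite -a0.
  pose G := complete_ptn (fun _ : {set bool} => b_gt0).
  apply: (@price_le_rcons R P G [:: true] false) => //=.
  - exact: no_elong.
  - by rewrite adj_complete.
  - by rewrite big_nil a0.
  - by rewrite big_seq1.
have a_gt0 : 0 < a%:num by rewrite lt_def a_neq0 /=.
(* The nodes are [Some false], [Some true] and [None]; the walk visits them in
   this order, so exactly its last edge contains [None]. *)
pose len (e : {set option bool}) := if None \in e then b%:num - a%:num else a%:num.
have len_gt0 e : 0 < len e by rewrite /len; case: ifP; rewrite ?subr_gt0.
pose G := complete_ptn len_gt0.
apply: (@price_le_rcons R P G [:: Some false; Some true] None) => //=.
- exact: no_elong.
- by rewrite adj_complete.
- by rewrite !adj_complete.
- by rewrite big_seq1 /len !inE.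
- by rewrite big_cons big_seq1 /len !inE /= addrC subrK.
Qed.
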